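(* Let $K$ be a fully chain-complete semiring, $\tau$ a finite relational vocabulary, $A$ a finite universe and $\pi:\mathrm{Lit}_A(\tau)\to K$ a $K$-interpretation. Then the semiring semantics of LFP is well-defined: for every LFP formula all least and greatest fixed points of update operators $F^\varphi_\pi$ required by the defining rules exist, so that $\pi[\![\psi]\!]\in K$ is well-defined for every LFP-sentence $\psi$ (with parameters from $A$).
   Context: A semiring is a commutative semiring $(K,+,\cdot,0,1)$, $0\ne1$, that is naturally ordered ($a\le b:\iff \exists c\,a+c=b$ is a partial order). $K$ is fully chain-complete if every chain $C\subseteq K$ has a supremum and an infimum in $K$. $\mathrm{Lit}_A(\tau)$ consists of atoms $R\bar a$ ($R\in\tau$, $\bar a\in A^{\mathrm{arity}(R)}$), their negations, and all $a=b$, $a\ne b$ with $a,b\in A$. A $K$-interpretation maps literals to $K$, true (in)equalities to $1$ and false ones to $0$. LFP extends first-order logic by $[\mathbf{lfp}\,R\bar x.\varphi](\bar x)$ and $[\mathbf{gfp}\,R\bar x.\varphi](\bar x)$ where $R$ occurs only positively in $\varphi$. Valuation rules: $\pi[\![\alpha\vee\beta]\!]=\pi[\![\alpha]\!]+\pi[\![\beta]\!]$, $\pi[\![\alpha\wedge\beta]\!]=\pi[\![\alpha]\!]\cdot\pi[\![\beta]\!]$, $\pi[\![\exists x\alpha(x)]\!]=\sum_{a\in A}\pi[\![\alpha(a)]\!]$, $\pi[\![\forall x\alpha(x)]\!]=\prod_{a\in A}\pi[\![\alpha(a)]\!]$, $\pi[\![\neg\alpha]\!]=\pi[\![\mathrm{nnf}(\neg\alpha)]\!]$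 (negation normal form, obtained via de Morgan laws and the lfp/gfp duality), literals evaluated by $\pi$. For $\varphi(R,\bar x)$ with $R$ of arity $m$, functions $g:A^m\to K$ are ordered pointwise, $\pi[R\mapsto g]$ extends $\pi$ by the values $g(\bar c)$ for atoms $R\bar c$, $F^\varphi_\pi(g)(\bar a)=\pi[R\mapsto g][\![\varphi(R,\bar a)]\!]$, and $\pi[\![[\mathbf{lfp}\,R\bar x.\varphi](\bar a)]\!]=\mathrm{lfp}(F^\varphi_\pi)(\bar a)$, $\pi[\![[\mathbf{gfp}\,R\bar x.\varphi](\bar a)]\!]=\mathrm{gfp}(F^\varphi_\pi)(\bar a)$. *)

(* Defs.v *)
From Stdlib Require Import Relation_Definitions.
From mathcomp Require Import all_boot all_algebra.
From mathcomp Require Import classical_sets.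

Set Implicit Arguments.
Unset Strict Implicit.
Unset Printing Implicit Defensive.

Import GRing.Theory.
Local Open Scope ring_scope.

Section NaturalOrder.
Variable K : comNzSemiRingType.

Definition nle (a b : K) : Prop := exists c, a + c = b.

Definition naturally_ordered : Prop := Relation_Definitions.order K nle.

Definition is_sup (C : set K) (s : K) : Prop :=
  (forall c, C c -> nle c s) /\
  (forall u, (forall c, C c -> nle c u) -> nle s u).

Definition is_inf (C : set K) (s : K) : Prop :=
  (forall c, C c -> nle s c) /\
  (forall l, (forall c, C c -> nle l c) -> nle l s).

(* The empty chain counts: K has a least and a greatest element. *)
Definition fully_chain_complete : Prop :=
  forall C : set K, total_on C nle ->
    (exists s, is_sup C s) /\ (exists s, is_inf C s).

Definition pointwise_le (I : finType) (g h : {ffun I -> K}) : Prop :=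
  forall i, nle (g i) (h i).

End NaturalOrder.

Variant fix_kind := LFP | GFP.

Definition dual_kind (mu : fix_kind) : fix_kind :=
  match mu with LFP => GFP | GFP => LFP end.

(* h is the least (for LFP) or the greatest (for GFP) fixed point of F. *)
Definition is_fixed_point (K : comNzSemiRingType) (I : finType)
    (mu : fix_kind) (F : {ffun I -> K} -> {ffun I -> K})
    (h : {ffun I -> K}) : Prop :=
  F h = h /\
  forall g, F g = g ->
    match mu with LFP => pointwise_le h g | GFP => pointwise_le g h end.

Record vocabulary := Vocabulary { symbol :> finType; arity : symbol -> nat }.

Inductive literal (tau : vocabulary) (A : Type) :=
| LAtom (R : tau) (a : (arity R).-tuple A)
| LNegAtom (R : tau) (a : (arity R).-tuple A)
| LEq (a b : A)
| LNeq (a b : A).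
Arguments LEq {tau A} a b.
Arguments LNeq {tau A} a b.

Definition is_interpretation (K : comNzSemiRingType) (tau : vocabulary)
    (A : finType) (pi : literal tau A -> K) : Prop :=
  forall a b : A,
    pi (LEq a b) = (if a == b then 1 else 0) /\
    pi (LNeq a b) = (if a == b then 0 else 1).

(* A fixed-point relation variable is a pair (name, arity); these variables
   are disjoint from the symbols of the vocabulary. *)
Definition relvar : Type := (nat * nat)%type.
Definition rarity (X : relvar) : nat := X.2.

(* Element variables, or elements of the universe used as parameters. *)
Inductive term (A : Type) := Var (x : nat) | Elt (a : A).
Arguments Var {A} x.

(* Fix mu X xs phi ts is [lfp X xs. phi](ts) or [gfp X xs. phi](ts). *)
Inductive formula (tau : vocabulary) (A : Type) :=
| Atom (R : tau) (ts : (arity R).-tuple (term A))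
| RAtom (X : relvar) (ts : (rarity X).-tuple (term A))
| Eq (t u : term A)
| Neg (phi : formula tau A)
| Or (phi psi : formula tau A)
| And (phi psi : formula tau A)
| Ex (x : nat) (phi : formula tau A)
| All (x : nat) (phi : formula tau A)
| Fix (mu : fix_kind) (X : relvar) (xs : (rarity X).-tuple nat)
    (phi : formula tau A) (ts : (rarity X).-tuple (term A)).

Arguments RAtom {tau A} X ts.
Arguments Eq {tau A} t u.
Arguments Fix {tau A} mu X xs phi ts.

Section Syntax.
Variables (tau : vocabulary) (A : Type).
Implicit Types (phi psi : formula tau A) (X Y : relvar).

(* Every free occurrence of X in phi is under an even (s = true) or odd
   (s = false) number of negations. *)
Fixpoint occurs_with_sign X (s : bool) phi : bool :=
  match phi with
  | Atom _ _ | Eq _ _ => true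
  | RAtom Y _ => (Y == X) ==> s
  | Neg psi => occurs_with_sign X (~~ s) psi
  | Or psi1 psi2 | And psi1 psi2 =>
      occurs_with_sign X s psi1 && occurs_with_sign X s psi2
  | Ex _ psi | All _ psi => occurs_with_sign X s psi
  | Fix _ Y _ psi _ => (Y == X) || occurs_with_sign X s psi
  end.

Definition occurs_positively X phi : bool := occurs_with_sign X true phi.

Fixpoint lfp_formula phi : bool :=
  match phi with
  | Atom _ _ | RAtom _ _ | Eq _ _ => true
  | Neg psi | Ex _ psi | All _ psi => lfp_formula psi
  | Or psi1 psi2 | And psi1 psi2 => lfp_formula psi1 && lfp_formula psi2
  | Fix _ X xs psi _ => [&& uniq xs, occurs_positively X psi & lfp_formula psi]
  end.

Fixpoint free_relvars phi : seq relvar :=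
  match phi with
  | Atom _ _ | Eq _ _ => [::]
  | RAtom X _ => [:: X]
  | Neg psi | Ex _ psi | All _ psi => free_relvars psi
  | Or psi1 psi2 | And psi1 psi2 => free_relvars psi1 ++ free_relvars psi2
  | Fix _ X _ psi _ => [seq Y <- free_relvars psi | Y != X]
  end.

Definition term_vars (t : term A) : seq nat :=
  match t with Var x => [:: x] | Elt _ => [::] end.

Fixpoint free_vars phi : seq nat :=
  match phi with
  | Atom _ ts | RAtom _ ts => flatten (map term_vars ts)
  | Eq t u => term_vars t ++ term_vars u
  | Neg psi => free_vars psi
  | Or psi1 psi2 | And psi1 psi2 => free_vars psi1 ++ free_vars psi2
  | Ex x psi | All x psi => [seq y <- free_vars psi | y != x]
  | Fix _ _ xs psi ts =>
      [seq y <- free_vars psi | y \notin val xs] ++ flatten (map term_vars ts)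
  end.

Definition lfp_sentence phi : bool :=
  [&& lfp_formula phi, nilp (free_relvars phi) & nilp (free_vars phi)].

(* Let phi' be phi with every free occurrence of each Y in D replaced by ~Y.
   nnf D true phi is the negation normal form of phi', nnf D false phi that
   of ~phi'. The set D is needed for the duality
     ~[lfp X xs. phi](ts)  ==  [gfp X xs. ~phi[X/~X]](ts). *)
Fixpoint nnf (D : seq relvar) (s : bool) phi : formula tau A :=
  match phi with
  | Atom R ts => if s then Atom ts else Neg (Atom ts)
  | RAtom X ts => if s (+) (X \in D) then RAtom X ts else Neg (RAtom X ts)
  | Eq t u => if s then Eq t u else Neg (Eq t u)
  | Neg psi => nnf D (~~ s) psi
  | Or psi1 psi2 =>
      if s then Or (nnf D s psi1) (nnf D s psi2)
      else And (nnf D s psi1) (nnf D s psi2)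
  | And psi1 psi2 =>
      if s then And (nnf D s psi1) (nnf D s psi2)
      else Or (nnf D s psi1) (nnf D s psi2)
  | Ex x psi => if s then Ex x (nnf D s psi) else All x (nnf D s psi)
  | All x psi => if s then All x (nnf D s psi) else Ex x (nnf D s psi)
  | Fix mu X xs psi ts =>
      if s then Fix mu X xs (nnf [seq Y <- D | Y != X] true psi) ts
      else Fix (dual_kind mu) X xs (nnf (X :: D) false psi) ts
  end.

Definition assign (xs : seq nat) (cs : seq A) (y : nat) : option A :=
  onth cs (index y xs).

Definition subst_term (th : nat -> option A) (t : term A) : term A :=
  match t with
  | Var x => if th x is Some a then Elt a else Var x
  | Elt a => Elt a
  end.

Definition unassign (xs : seq nat) (th : nat -> option A) (y : nat) : option A :=
  if y \in xs then None else th y.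

Fixpoint subst (th : nat -> option A) phi : formula tau A :=
  match phi with
  | Atom R ts => Atom (map_tuple (subst_term th) ts)
  | RAtom X ts => RAtom X (map_tuple (subst_term th) ts)
  | Eq t u => Eq (subst_term th t) (subst_term th u)
  | Neg psi => Neg (subst th psi)
  | Or psi1 psi2 => Or (subst th psi1) (subst th psi2)
  | And psi1 psi2 => And (subst th psi1) (subst th psi2)
  | Ex x psi => Ex x (subst (unassign [:: x] th) psi)
  | All x psi => All x (subst (unassign [:: x] th) psi)
  | Fix mu X xs psi ts =>
      Fix mu X xs (subst (unassign xs th) psi) (map_tuple (subst_term th) ts)
  end.

(* phi(cs), the simultaneous substitution of the elements cs for xs. *)
Definition inst (xs : seq nat) (cs : seq A) phi : formula tau A :=
  subst (assign xs cs) phi.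

Definition elts n (a : n.-tuple A) : n.-tuple (term A) := map_tuple (@Elt A) a.

End Syntax.

Section Semantics.
Variables (K : comNzSemiRingType) (tau : vocabulary) (A : finType).
Variable pi : literal tau A -> K.

(* The part of pi[X1 |-> g1]...[Xk |-> gk] that concerns relation variables:
   it is partial and gives values to positive atoms X c only. *)
Definition rel_env : Type :=
  forall X : relvar, option {ffun (rarity X).-tuple A -> K}.

Definition empty_env : rel_env := fun X => None.

Definition extend_env (rho : rel_env) (X : relvar)
    (g : {ffun (rarity X).-tuple A -> K}) : rel_env :=
  dfwith rho (Some g).

(* eval rho phi k : the defining rules assign the value k to phi under pi
   extended by rho. In the fixed-point rule F is the update operator, and the
   rule applies only if F has the required fixed point. *)
Inductive eval : rel_env -> formula tau A -> K -> Prop :=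
| eval_atom rho (R : tau) (a : (arity R).-tuple A) :
    eval rho (Atom (elts a)) (pi (LAtom a))
| eval_neg_atom rho (R : tau) (a : (arity R).-tuple A) :
    eval rho (Neg (Atom (elts a))) (pi (LNegAtom a))
| eval_eq rho a b :
    eval rho (Eq (Elt a) (Elt b)) (pi (LEq a b))
| eval_neq rho a b :
    eval rho (Neg (Eq (Elt a) (Elt b))) (pi (LNeq a b))
| eval_ratom rho X (g : {ffun (rarity X).-tuple A -> K}) a :
    rho X = Some g ->
    eval rho (RAtom X (elts a)) (g a)
| eval_or rho phi psi k l :
    eval rho phi k -> eval rho psi l -> eval rho (Or phi psi) (k + l)
| eval_and rho phi psi k l :
    eval rho phi k -> eval rho psi l -> eval rho (And phi psi) (k * l)
| eval_ex rho x phi (f : A -> K) :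
    (forall a, eval rho (inst [:: x] [:: a] phi) (f a)) ->
    eval rho (Ex x phi) (\sum_(a : A) f a)
| eval_all rho x phi (f : A -> K) :
    (forall a, eval rho (inst [:: x] [:: a] phi) (f a)) ->
    eval rho (All x phi) (\prod_(a : A) f a)
| eval_neg rho phi k :
    eval rho (nnf [::] true (Neg phi)) k ->
    eval rho (Neg phi) k
| eval_fix rho mu X (xs : (rarity X).-tuple nat) phi
    (a : (rarity X).-tuple A)
    (F : {ffun (rarity X).-tuple A -> K} -> {ffun (rarity X).-tuple A -> K})
    (h : {ffun (rarity X).-tuple A -> K}) :
    (forall g (c : (rarity X).-tuple A),
       eval (extend_env rho g) (inst xs c phi) (F g c)) ->
    is_fixed_point mu F h ->
    eval rho (Fix mu X xs phi (elts a)) (h a).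

(* F is the update operator of phi(X, xs): for all g and c, F g c is the one
   and only value of phi(X, c) under pi[X |-> g]. *)
Definition is_update_operator (rho : rel_env) (X : relvar)
    (xs : (rarity X).-tuple nat) (phi : formula tau A)
    (F : {ffun (rarity X).-tuple A -> K} -> {ffun (rarity X).-tuple A -> K}) :
    Prop :=
  forall g (c : (rarity X).-tuple A) k,
    eval (extend_env rho g) (inst xs c phi) k <-> k = F g c.

(* The formulas that the defining rules have to evaluate under rho: LFP
   formulas without free element variables, whose free relation variables
   (those bound by fixed-point operators further out) occur positively and are
   interpreted by rho. *)
Definition evaluable (rho : rel_env) (phi : formula tau A) : Prop :=
  [/\ lfp_formula phi, free_vars phi = [::] &
      forall X, X \in free_relvars phi -> occurs_positively X phi /\ rho X].

End Semantics.

(* Main.v *)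
(** Sums, products and fixed points are monotone in the values of positively
    occurring relation variables, so update operators are monotone. A monotone
    operator [F] on a chain-complete poset has a least fixed point: the [x] with
    [x <= F x] below every prefixed point of [F] are closed under [F] and under
    suprema of chains, and a maximal one, given by Zorn's lemma, is fixed.
    As the least fixed point lies below all prefixed points, it is itself
    monotone in [F]. Greatest fixed points are dual. Values exist, are unique
    and are monotone by a simultaneous induction on a weight that decreases
    when a negation is pushed inwards. *)
Require Import Defs.
From Stdlib Require Import Relation_Definitions.
From mathcomp Require Import all_boot all_algebra.
From mathcomp Require Import boolp classical_sets.

Set Implicit Arguments.
Unset Strict Implicit.
Unset Printing Implicit Defensive.

Import GRing.Theory.
Local Open Scope ring_scope.

(** * Least fixed points on chain-complete posets *)

Definition chain_sups (T : Type) (R : T -> T -> Prop) : Prop :=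
  forall C : set T, total_on C R ->
  exists s, (forall c, C c -> R c s) /\
            (forall u, (forall c, C c -> R c u) -> R s u).

(** The bound holds for all prefixed points, not just fixed ones; this is what later allows fixed
    points of different operators to be compared. *)
Lemma least_prefixed_point (T : Type) (R : T -> T -> Prop) (F : T -> T) :
  Relation_Definitions.order T R -> chain_sups R ->
  (forall x y, R x y -> R (F x) (F y)) ->
  exists h, F h = h /\ forall g, R (F g) g -> R h g.
Proof.
case=> Rrefl Rtrans Ranti supR monoF.
pose S x := R x (F x) /\ forall g, R (F g) g -> R x g.
(* [Zorn] expects a boolean relation on a whole type, so the order is restricted to the subtype [S]
   and reflected by [asbool]. *)
pose RS (u v : {x | S x}) := `[< R (sval u) (sval v) >].
have [||||[m Sm] maxm] := @Zorn {x | S x} RS.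
- by move=> u; apply/asboolP/Rrefl.
- by move=> u v w /asboolP uv /asboolP vw; apply/asboolP/Rtrans/vw.
- by move=> [u Su] [v Sv] /asboolP uv /asboolP vu; apply/eq_exist/Ranti.
- move=> C totC.
  pose D : set T := fun x => exists Sx : S x, C (exist S x Sx).
  have totD : total_on D R.
    by move=> x y [Sx Cx] [Sy Cy]; have [/asboolP|/asboolP] := totC _ _ Cx Cy;
      [left|right].
  have [s [ubs lubs]] := supR D totD.
  have Ss : S s.
    split; last by move=> g Fg; apply: lubs => c [[_ cg] _]; apply: cg.
    (* Each [c] in the chain satisfies [c <= F c <= F s], so [F s] is an upper bound and
       [s <= F s]. *)
    apply: lubs => c Dc; have [[cF _] _] := Dc.
    by apply: (Rtrans _ (F c)) => //; apply/monoF/ubs.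
  exists (exist S s Ss) => -[x Sx] Cx; apply/asboolP/(ubs x).
  by exists Sx.
have [mF mg] := Sm.
have SF : S (F m).
  by split=> [|g Fg]; [apply: monoF | by apply: (Rtrans _ (F g)) => //; apply/monoF/mg].
exists m; split=> //.
(* [F m] lies in [S] above the maximal [m], hence equals it. *)
exact: (congr1 sval (maxm (exist S (F m) SF) (asboolT mF))).
Qed.

(** * The natural order, and fixed points of operators on functions into [K] *)

Section NaturalOrder.
Variable K : comNzSemiRingType.
Hypothesis hord : naturally_ordered K.
Implicit Types a b c d : K.

Lemma nle_refl a : nle a a.
Proof. by case: hord => + _ _; apply. Qed.

Lemma nle_trans a b c : nle a b -> nle b c -> nle a c.
Proof. by case: hord => _ + _; apply. Qed.

Lemma nle_anti a b : nle a b -> nle b a -> a = b.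
Proof. by case: hord => _ _; apply. Qed.

Lemma nle_add a b c d : nle a b -> nle c d -> nle (a + c) (b + d).
Proof. by move=> [x <-] [y <-]; exists (x + y); rewrite addrACA. Qed.

Lemma nle_mul a b c d : nle a b -> nle c d -> nle (a * c) (b * d).
Proof.
(* The witness is what remains of [(a + x) * (c + y)] after removing [a * c]. *)
move=> [x <-] [y <-]; exists (a * y + x * (c + y)).
by rewrite [RHS]mulrDl [X in _ = X + _]mulrDr addrA.
Qed.

(** The order is reversed for [GFP], so that both kinds of fixed point are least ones and share one
    existence proof. *)
Definition kind_le (I : finType) (mu : fix_kind) (g h : {ffun I -> K}) : Prop :=
  match mu with LFP => pointwise_le g h | GFP => pointwise_le h g end.

Lemma kind_le_order (I : finType) (mu : fix_kind) :
  Relation_Definitions.order {ffun I -> K} (kind_le mu).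
Proof.
split.
- by move=> g; case: mu => i; apply: nle_refl.
- by move=> g h k; case: mu => /= gh hk i; [apply: nle_trans (gh i) (hk i)
                                        | apply: nle_trans (hk i) (gh i)].
- by move=> g h; case: mu => /= gh hg; apply/ffunP => i; apply: nle_anti.
Qed.

(** Evaluating a chain of functions at [i] gives a chain in [K], so bounds are formed pointwise:
    suprema of [K] for [LFP], infima for [GFP]. *)
Lemma kind_le_chain_sups (I : finType) (mu : fix_kind) :
  fully_chain_complete K -> chain_sups (@kind_le I mu).
Proof.
move=> hK C totC.
pose Ci i : set K := fun k => exists2 g, C g & g i = k.
have totCi i : total_on (Ci i) (@nle K).
  move=> _ _ [g Cg <-] [h Ch <-].
  by have := totC g h Cg Ch; case: mu {totC} => /= -[] le;
    [left|right|right|left]; apply: le.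
case: mu {totC} => /=.
- have [s sP] := choice (fun i => (hK _ (totCi i)).1).
  exists [ffun i => s i]; split=> [g Cg i|u ubu i]; rewrite ffunE.
    by apply: (sP i).1; exists g.
  by apply: (sP i).2 => _ [g Cg <-]; apply: ubu.
- have [s sP] := choice (fun i => (hK _ (totCi i)).2).
  exists [ffun i => s i]; split=> [g Cg i|u ubu i]; rewrite ffunE.
    by apply: (sP i).1; exists g.
  by apply: (sP i).2 => _ [g Cg <-]; apply: ubu.
Qed.

Section FixedPoints.
Hypothesis hK : fully_chain_complete K.
Variables (I : finType) (mu : fix_kind).
Implicit Types F G : {ffun I -> K} -> {ffun I -> K}.

Definition monotone_op F : Prop :=
  forall g h, pointwise_le g h -> pointwise_le (F g) (F h).

Lemma fixed_point_prefixed F : monotone_op F ->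
  exists2 h, is_fixed_point mu F h &
    forall g, kind_le mu (F g) g -> kind_le mu h g.
Proof.
move=> monoF.
have [|h [Fh leh]] := least_prefixed_point (F := F) (kind_le_order I mu)
                        (kind_le_chain_sups hK).
  by case: mu => g h; apply: monoF.
exists h => //; split=> // g Fg; apply: leh.
by rewrite Fg; case: (kind_le_order I mu).
Qed.

(** Any fixed point of kind [mu] lies below the one constructed in [fixed_point_prefixed], and so
    inherits its bound. *)
Lemma fixed_point_le_prefixed F h g : monotone_op F -> is_fixed_point mu F h ->
  kind_le mu (F g) g -> kind_le mu h g.
Proof.
move=> /fixed_point_prefixed[h0 [Fh0 _] leh0] [_ leh] Fg.
have [_ trans _] := kind_le_order I mu.
by apply: (trans _ h0); [apply: leh | apply: leh0].
Qed.

End FixedPoints.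

(** For [LFP], [F g <= G g = g] makes [g] prefixed for [F]; for [GFP], [f = F f <= G f] makes [f]
    postfixed for [G]. *)
Lemma fixed_point_monotone (I : finType) mu (F G : {ffun I -> K} -> {ffun I -> K}) f g :
  fully_chain_complete K -> monotone_op F -> monotone_op G ->
  (forall h, pointwise_le (F h) (G h)) ->
  is_fixed_point mu F f -> is_fixed_point mu G g -> pointwise_le f g.
Proof.
move=> hK monoF monoG FG fF gG.
have [Ff _] := fF; have [Gg _] := gG.
case: mu fF gG => fF gG.
- apply: (fixed_point_le_prefixed hK monoF fF) => /=.
  by rewrite -[X in pointwise_le _ X]Gg; apply: FG.
- apply: (fixed_point_le_prefixed hK monoG gG) => /=.
  by rewrite -[X in pointwise_le X _]Ff; apply: FG.
Qed.

End NaturalOrder.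

(** * Substitution and negation normal form: weight, free variables, polarity *)

Section Syntax.
Variables (tau : vocabulary) (A : Type).
Implicit Types (phi psi : formula tau A) (X Y : relvar).

(* A negated atom weighs as much as the atom, so that normalization never
   increases the weight. *)
Fixpoint weight phi : nat :=
  match phi with
  | Atom _ _ | RAtom _ _ | Eq _ _ => 1
  | Neg psi =>
      match psi with
      | Atom _ _ | RAtom _ _ | Eq _ _ => 1
      | _ => (weight psi).+1
      end
  | Or psi1 psi2 | And psi1 psi2 => (weight psi1 + weight psi2).+1
  | Ex _ psi | All _ psi | Fix _ _ _ psi _ => (weight psi).+1
  end.

Lemma weight_le_neg phi : (weight phi <= weight (Neg phi))%N.
Proof. by case: phi. Qed.

Lemma weight_subst th phi : weight (subst th phi) = weight phi.
Proof.
elim: phi th => [R ts|Y ts|t u|p IH|p IHp q IHq|p IHp q IHq|x p IH|x p IH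
  |mu Y xs p IH ts] th //=; rewrite ?IH ?IHp ?IHq //.
(* Only the negation case remains: there [weight] inspects the shape of the body, which substitution
   preserves. *)
by case: p IH => //= *; congr _.+1; apply: (IH th).
Qed.

Lemma occurs_with_sign_subst X s th phi :
  occurs_with_sign X s (subst th phi) = occurs_with_sign X s phi.
Proof.
by elim: phi s th => [R ts|Y ts|t u|p IH|p IHp q IHq|p IHp q IHq|x p IH|x p IH
  |mu Y xs p IH ts] s th //=; rewrite ?IH ?IHp ?IHq.
Qed.

Lemma lfp_formula_subst th phi : lfp_formula (subst th phi) = lfp_formula phi.
Proof.
by elim: phi th => [R ts|Y ts|t u|p IH|p IHp q IHq|p IHp q IHq|x p IH|x p IH
  |mu Y xs p IH ts] th //=;
  rewrite ?IH ?IHp ?IHq // /occurs_positively occurs_with_sign_subst.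
Qed.

Lemma free_relvars_subst th phi : free_relvars (subst th phi) = free_relvars phi.
Proof.
by elim: phi th => [R ts|Y ts|t u|p IH|p IHp q IHq|p IHp q IHq|x p IH|x p IH
  |mu Y xs p IH ts] th //=; rewrite ?IH ?IHp ?IHq.
Qed.

Lemma mem_term_vars_subst th y (t : term A) :
  y \in term_vars (subst_term th t) -> y \in term_vars t /\ th y = None.
Proof.
case: t => [x|a] //=; case E: (th x) => [a|] //=.
by rewrite inE => /eqP->.
Qed.

Lemma mem_terms_vars_subst th y (ts : seq (term A)) :
  y \in flatten (map (@term_vars A) (map (subst_term th) ts)) ->
  y \in flatten (map (@term_vars A) ts) /\ th y = None.
Proof.
elim: ts => //= t ts IH; rewrite !mem_cat.
by case/orP => [/mem_term_vars_subst[->]|/IH[->]]; rewrite ?orbT.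
Qed.

Lemma mem_free_vars_subst th y phi :
  y \in free_vars (subst th phi) -> y \in free_vars phi /\ th y = None.
Proof.
elim: phi th => [R ts|X ts|t u|psi IH|p IHp q IHq|p IHp q IHq|x p IH|x p IH
  |mu X xs p IH ts] th /=.
- exact: mem_terms_vars_subst.
- exact: mem_terms_vars_subst.
- by rewrite !mem_cat => /orP[] /mem_term_vars_subst[->]; rewrite ?orbT.
- exact: IH.
- by rewrite !mem_cat => /orP[/IHp|/IHq] [->]; rewrite ?orbT.
- by rewrite !mem_cat => /orP[/IHp|/IHq] [->]; rewrite ?orbT.
- rewrite !mem_filter => /andP[yx /IH[-> +]].
  by rewrite /unassign inE (negPf yx).
- rewrite !mem_filter => /andP[yx /IH[-> +]].
  by rewrite /unassign inE (negPf yx).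
- rewrite !mem_cat => /orP[|/mem_terms_vars_subst[->]]; last by rewrite orbT.
  rewrite !mem_filter => /andP[yx /IH[-> +]].
  by rewrite /unassign (negPf yx).
Qed.

Lemma free_vars_inst (xs : seq nat) (cs : seq A) phi :
  size cs = size xs -> {subset free_vars phi <= xs} ->
  free_vars (inst xs cs phi) = [::].
Proof.
move=> eqsz sub; case E: (free_vars _) => [|y ys] //.
have /mem_free_vars_subst[/sub yxs] : y \in free_vars (inst xs cs phi).
  by rewrite E mem_head.
(* As [cs] is as long as [xs], every variable in [xs] is assigned an element, so [y] cannot have
   survived the substitution. *)
by move: yxs; rewrite /assign -index_mem -eqsz -onthTE => + none; rewrite none.
Qed.

Lemma weight_nnf D s phi : (weight (nnf D s phi) <= weight phi)%N.
Proof.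
elim: phi D s => [R ts|X ts|t u|psi IH|p IHp q IHq|p IHp q IHq|x p IH|x p IH
  |mu X xs p IH ts] D s.
- by case: s.
- by rewrite [nnf _ _ _]/=; case: (s (+) _).
- by case: s.
- exact: leq_trans (IH _ _) (weight_le_neg _).
- by case: s; rewrite /= ltnS leq_add.
- by case: s; rewrite /= ltnS leq_add.
- by case: s; rewrite /= ltnS.
- by case: s; rewrite /= ltnS.
- by case: s; rewrite /= ltnS.
Qed.

Lemma free_vars_nnf D s phi : free_vars (nnf D s phi) = free_vars phi.
Proof.
elim: phi D s => [R ts|X ts|t u|psi IH|p IHp q IHq|p IHp q IHq|x p IH|x p IH
  |mu X xs p IH ts] D s /=; rewrite ?IH //; try by case: s; rewrite /= ?IHp ?IHq ?IH.
by case: (s (+) _).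
Qed.

Lemma free_relvars_nnf D s phi : free_relvars (nnf D s phi) = free_relvars phi.
Proof.
elim: phi D s => [R ts|X ts|t u|psi IH|p IHp q IHq|p IHp q IHq|x p IH|x p IH
  |mu X xs p IH ts] D s /=; rewrite ?IH //; try by case: s; rewrite /= ?IHp ?IHq ?IH.
by case: (s (+) _).
Qed.

(** The polarity of [X] flips once if the formula is negated ([s = false]) and once more if [X] is
    itself dualized ([X] in [D]). *)
Lemma occurs_with_sign_nnf X t D s phi :
  occurs_with_sign X t (nnf D s phi) =
  occurs_with_sign X (t (+) ~~ (s (+) (X \in D))) phi.
Proof.
elim: phi t D s => [R ts|Y ts|u v|psi IH|p IHp q IHq|p IHp q IHq|x p IH|x p IH
  |mu Y xs p IH ts] t D s; try by case: s; rewrite /= ?IHp ?IHq ?IH.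
- rewrite /=; have [eqYX|neq] := eqVneq Y X; last by case: ifP; rewrite /= (negPf neq).
  by case: X / eqYX; case: s; case: (Y \in D); case: t; rewrite /= eqxx.
- by rewrite /= IH; case: s; case: (X \in D); case: t.
- have [eqYX|neq] := eqVneq Y X; first by case: X / eqYX {IH}; case: s; rewrite /= eqxx.
  by case: s; rewrite /= (negPf neq) IH ?mem_filter ?inE (eq_sym X Y) (negPf neq).
Qed.

(** At a fixed point, the bound [X] is either removed from [D] with [s = true] or added to [D] with
    [s = false]. Its polarity flips not at all or twice, and so it stays positive. *)
Lemma lfp_formula_nnf D s phi : lfp_formula (nnf D s phi) = lfp_formula phi.
Proof.
elim: phi D s => [R ts|Y ts|u v|psi IH|p IHp q IHq|p IHp q IHq|x p IH|x p IH
  |mu Y xs p IH ts] D s; try by case: s; rewrite /= ?IHp ?IHq ?IH.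
- by rewrite /=; case: ifP.
- by case: s; rewrite /= IH /occurs_positively occurs_with_sign_nnf
    ?mem_filter ?inE eqxx.
Qed.

Lemma elts_inj n : injective (@elts A n).
Proof.
by move=> a b /(congr1 val) /= /inj_map eqab; apply/val_inj/eqab => x y [].
Qed.

(** The rules of [eval] for atoms and fixed points apply to argument tuples of the form [elts a]
    only. *)
Lemma closed_terms n (ts : n.-tuple (term A)) :
  flatten (map (@term_vars A) ts) = [::] -> exists a, ts = elts a.
Proof.
case: ts => ts /= szts closed.
have [a ats] : exists a, ts = map (@Elt A) a.
  elim: ts closed {szts} => [|[x|a] ts IH] //=; first by exists [::].
  by move=> /IH[b ->]; exists (a :: b).
have sza : size a == n by rewrite -(eqP szts) ats size_map.
by exists (Tuple sza); apply: val_inj.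
Qed.

End Syntax.

(** * Inversion of evaluation, comparison of environments, and evaluability of the formulas in
    premises *)

Section Semantics.
Variables (K : comNzSemiRingType) (tau : vocabulary) (A : finType).
Variable pi : literal tau A -> K.
Implicit Types (rho : rel_env K A) (phi psi : formula tau A) (X : relvar).

(* The premise of [eval_neg] at a negated atom is its own conclusion, hence the
   induction. *)
Lemma eval_inv rho phi k : eval pi rho phi k ->
  match phi with
  | Atom R ts => exists2 a, ts = elts a & k = pi (LAtom a)
  | RAtom X ts => exists a, exists2 g, ts = elts a & rho X = Some g /\ k = g a
  | Eq t u => exists a, exists2 b, t = Elt a /\ u = Elt b & k = pi (LEq a b)
  | Neg (Atom R ts) => exists2 a, ts = elts a & k = pi (LNegAtom a)
  | Neg (Eq t u) =>
      exists a, exists2 b, t = Elt a /\ u = Elt b & k = pi (LNeq a b)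
  | Neg (RAtom X ts) => False
  | Neg psi => eval pi rho (nnf [::] false psi) k
  | Or psi1 psi2 => exists k1, exists2 k2,
      eval pi rho psi1 k1 /\ eval pi rho psi2 k2 & k = k1 + k2
  | And psi1 psi2 => exists k1, exists2 k2,
      eval pi rho psi1 k1 /\ eval pi rho psi2 k2 & k = k1 * k2
  | Ex x psi => exists2 f,
      (forall a, eval pi rho (inst [:: x] [:: a] psi) (f a)) & k = \sum_a f a
  | All x psi => exists2 f,
      (forall a, eval pi rho (inst [:: x] [:: a] psi) (f a)) & k = \prod_a f a
  | Fix mu X xs psi ts => exists a,
      exists F : {ffun (rarity X).-tuple A -> K} -> {ffun (rarity X).-tuple A -> K},
      exists2 h, ts = elts a &
      [/\ forall g (c : (rarity X).-tuple A),
            eval pi (extend_env rho g) (inst xs c psi) (F g c),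
          is_fixed_point mu F h & k = h a]
  end.
Proof.
elim=> {rho phi k}.
- by move=> rho R a; exists a.
- by move=> rho R a; exists a.
- by move=> rho a b; exists a, b.
- by move=> rho a b; exists a, b.
- by move=> rho X g a Xg; exists a, g.
- by move=> rho phi psi k l ek _ el _; exists k, l.
- by move=> rho phi psi k l ek _ el _; exists k, l.
- by move=> rho x phi f ef _; exists f.
- by move=> rho x phi f ef _; exists f.
- by move=> rho phi k ek IH; case: phi ek IH.
- by move=> rho mu X xs phi a F h eF _ hF; exists a, F, h.
Qed.

(** Only the variables in [Xs], in use the free ones of a formula, are compared, and only where both
    partial environments are defined. *)
Definition env_le (Xs : seq relvar) rho rho' : Prop :=
  forall X, X \in Xs -> forall g g',
  rho X = Some g -> rho' X = Some g' -> pointwise_le g g'.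

Lemma env_le_refl (hord : naturally_ordered K) Xs rho : env_le Xs rho rho.
Proof. by move=> X _ g _ -> [<-] i; apply: nle_refl. Qed.

Lemma env_le_sub Xs Ys rho rho' :
  {subset Xs <= Ys} -> env_le Ys rho rho' -> env_le Xs rho rho'.
Proof. by move=> sub le X /sub; apply: le. Qed.

Lemma extend_env_le Xs rho rho' X (g g' : {ffun (rarity X).-tuple A -> K}) :
  env_le [seq Y <- Xs | Y != X] rho rho' -> pointwise_le g g' ->
  env_le Xs (extend_env rho g) (extend_env rho' g').
Proof.
move=> le gg' Y YXs h h'; rewrite /extend_env.
(* The type of [g] depends on [X], so the equality is eliminated to identify the types before
   [dfwith] can be computed. *)
have [eqYX|neq] := eqVneq X Y.
  by case: Y / eqYX {YXs} h h' => h h'; rewrite !dfwith_in => -[<-] [<-].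
by rewrite !dfwith_out //; apply: le; rewrite mem_filter eq_sym neq.
Qed.

Lemma evaluable_inst rho (xs : seq nat) (cs : seq A) psi :
  lfp_formula psi -> size cs = size xs -> {subset free_vars psi <= xs} ->
  (forall X, X \in free_relvars psi -> occurs_positively X psi /\ rho X) ->
  evaluable rho (inst xs cs psi).
Proof.
move=> lf sz sub pos; split; first by rewrite /inst lfp_formula_subst.
  exact: free_vars_inst.
rewrite /inst free_relvars_subst => X /pos.
by rewrite /occurs_positively occurs_with_sign_subst.
Qed.

Lemma evaluable_quant rho x a psi : lfp_formula psi ->
  [seq y <- free_vars psi | y != x] = [::] ->
  (forall X, X \in free_relvars psi -> occurs_positively X psi /\ rho X) ->
  evaluable rho (inst [:: x] [:: a] psi).
Proof.
move=> lf fv; apply: evaluable_inst => // y yfv; rewrite inE; apply/negPn/negP => yx.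
by have : y \in [::] by rewrite -fv mem_filter yx.
Qed.

(** The bound [X] is positive in [psi] by [lfp_formula] and gets its value from [g]; every other
    free relation variable is inherited from the fixed-point formula. *)
Lemma evaluable_fix rho mu X (xs : (rarity X).-tuple nat) psi ts
    (g : {ffun (rarity X).-tuple A -> K}) (c : (rarity X).-tuple A) :
  evaluable rho (Fix mu X xs psi ts) ->
  evaluable (extend_env rho g) (inst xs c psi).
Proof.
move=> [/= /and3P[_ posX lf] /nilP fv pos].
apply: evaluable_inst => //; first by rewrite !size_tuple.
  move: fv; rewrite cat_nilp => /andP[/nilP fv _] y yfv; apply/negPn/negP => yx.
  by have : y \in [::] by rewrite -fv mem_filter yx.
move=> Y Yfr; rewrite /extend_env.
have [eqYX|neq] := eqVneq X Y; first by case: Y / eqYX Yfr; rewrite dfwith_in.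
have /pos[] : Y \in [seq Z <- free_relvars psi | Z != X].
  by rewrite mem_filter eq_sym neq.
by rewrite dfwith_out // /occurs_positively /= (negPf neq).
Qed.

(** With [D] empty and [s = false], polarities in [psi] flip exactly as they do under [Neg]. *)
Lemma evaluable_nnf rho psi :
  evaluable rho (Neg psi) -> evaluable rho (nnf [::] false psi).
Proof.
case=> lf fv pos; split; rewrite ?lfp_formula_nnf ?free_vars_nnf //.
by rewrite free_relvars_nnf => X /pos; rewrite /occurs_positively occurs_with_sign_nnf.
Qed.

Lemma evaluable_cat rho phi psi :
  lfp_formula phi && lfp_formula psi ->
  free_vars phi ++ free_vars psi = [::] ->
  (forall X, X \in free_relvars phi ++ free_relvars psi ->
     occurs_positively X phi && occurs_positively X psi /\ rho X) ->
  evaluable rho phi /\ evaluable rho psi.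
Proof.
move=> /andP[lf1 lf2] /nilP; rewrite cat_nilp => /andP[/nilP fv1 /nilP fv2] pos.
by split; split=> // X Xfr; (have /pos[/andP[]] : X \in free_relvars phi ++ free_relvars psi
  by rewrite mem_cat Xfr ?orbT).
Qed.

(** * Existence, uniqueness and monotonicity of values *)

Section WellDefined.
Hypotheses (hord : naturally_ordered K) (hK : fully_chain_complete K).

Definition has_value phi : Prop :=
  forall rho, evaluable rho phi -> exists k, eval pi rho phi k.

(** This includes uniqueness: with equal environments, two values of [phi] bound each other, and
    antisymmetry applies. *)
Definition monotone_value phi : Prop :=
  forall rho rho' k k', evaluable rho phi -> evaluable rho' phi ->
  env_le (free_relvars phi) rho rho' ->
  eval pi rho phi k -> eval pi rho' phi k' -> nle k k'.

Section Fix.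
Variables (mu : fix_kind) (X : relvar) (xs : (rarity X).-tuple nat) (psi : formula tau A).
Variable ts : (rarity X).-tuple (term A).
Hypothesis val : forall c : (rarity X).-tuple A, has_value (inst xs c psi).
Hypothesis mono : forall c : (rarity X).-tuple A, monotone_value (inst xs c psi).
Implicit Types F : {ffun (rarity X).-tuple A -> K} -> {ffun (rarity X).-tuple A -> K}.

(** Stated for two environments and two operators to serve twice: [F = F'] gives monotonicity of an
    update operator, [g = g'] compares the operators of two environments. *)
Lemma body_monotone rho rho' F F' g g' :
  evaluable rho (Fix mu X xs psi ts) -> evaluable rho' (Fix mu X xs psi ts) ->
  env_le (free_relvars (Fix mu X xs psi ts)) rho rho' ->
  (forall g (c : (rarity X).-tuple A),
     eval pi (extend_env rho g) (inst xs c psi) (F g c)) ->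
  (forall g (c : (rarity X).-tuple A),
     eval pi (extend_env rho' g) (inst xs c psi) (F' g c)) ->
  pointwise_le g g' -> pointwise_le (F g) (F' g').
Proof.
move=> ev ev' le eF eF' gg' c.
apply: mono (eF g c) (eF' g' c); [exact: evaluable_fix ev|exact: evaluable_fix ev'|].
by rewrite /inst free_relvars_subst; apply: extend_env_le.
Qed.

Lemma update_operator_exists rho : evaluable rho (Fix mu X xs psi ts) ->
  exists F, is_update_operator pi rho xs psi F /\ exists h, is_fixed_point mu F h.
Proof.
move=> ev.
(* One value is chosen for each pair of a function [g] and a tuple [c]; these values assemble into
   the update operator. *)
have [f fP] := choice (fun gc => val (evaluable_fix gc.1 gc.2 ev)).
pose F (g : {ffun (rarity X).-tuple A -> K}) : {ffun (rarity X).-tuple A -> K} :=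
  [ffun c => f (g, c)].
have eF g (c : (rarity X).-tuple A) : eval pi (extend_env rho g) (inst xs c psi) (F g c).
  by rewrite ffunE; apply: (fP (g, c)).
exists F; split.
  move=> g c k; split=> [ek|->//].
  (* Uniqueness of the value, from monotonicity in both directions. *)
  by apply: (nle_anti hord); [apply: mono ek (eF g c)|apply: mono (eF g c) ek];
    do ?[exact: evaluable_fix ev|exact: env_le_refl].
have [g h gh|h hF _] := fixed_point_prefixed hord hK mu (F := F); last by exists h.
exact: (body_monotone ev ev (@env_le_refl hord _ _) eF eF gh).
Qed.

Lemma has_value_fix : has_value (Fix mu X xs psi ts).
Proof.
move=> rho ev; have [F [eF [h hF]]] := update_operator_exists ev.
have [_ /nilP + _] := ev; rewrite /= cat_nilp => /andP[_ /nilP /closed_terms[a ->]].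
by exists (h a); apply: eval_fix hF => g c; apply/eF.
Qed.

Lemma monotone_value_fix : monotone_value (Fix mu X xs psi ts).
Proof.
move=> rho rho' k k' ev ev' le /eval_inv[a [F [h tsa [eF hF ->]]]].
move=> /eval_inv[a' [F' [h' tsa' [eF' hF' ->]]]].
have -> : a' = a by apply: elts_inj; rewrite -tsa.
apply: (fixed_point_monotone hord hK _ _ _ hF hF' a).
- by move=> g g'; apply: (body_monotone ev ev (@env_le_refl hord _ _) eF eF).
- by move=> g g'; apply: (body_monotone ev' ev' (@env_le_refl hord _ _) eF' eF').
- move=> g; apply: (body_monotone ev ev' le eF eF').
  by move=> i; apply: nle_refl.
Qed.

End Fix.

(** The two claims are proved together, since the existence of a fixed point rests on monotonicity
    of its body. Structural induction would fail: the rules pass to instances and normal forms,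
    which need not be subformulas. *)
Lemma eval_total_monotone phi : has_value phi /\ monotone_value phi.
Proof.
have [n] := ubnP (weight phi); elim: n phi => // n IH phi.
case: phi => [R ts|X ts|t u|psi|p q|p q|x p|x p|mu X xs p ts] wt.
- split=> [rho [_ /closed_terms[a ->] _]|]; first by eexists; apply: eval_atom.
  move=> rho rho' k k' _ _ _ /eval_inv[a -> ->] /eval_inv[b /elts_inj -> ->].
  exact: nle_refl.
- split=> [rho [_ /closed_terms[a ->] pos]|].
    have [_] := pos X (mem_head _ _); case E: (rho X) => [g|] // _.
    by exists (g a); apply: eval_ratom.
  move=> rho rho' k k' _ _ le /eval_inv[a [g -> [Xg ->]]].
  by move=> /eval_inv[b [g' /elts_inj -> [Xg' ->]]]; apply: le Xg Xg' _; rewrite mem_head.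
- split=> [rho [_ /= fv _]|].
    case: t u fv {wt} => [x|a] [y|b] //= _; by eexists; apply: eval_eq.
  move=> rho rho' k k' _ _ _ /eval_inv[a [b [-> ->] ->]] /eval_inv[c [d [[->] [->]] ->]].
  exact: nle_refl.
(* For a non-literal [psi], the normal form weighs at most [weight psi], strictly less than
   [Neg psi]. *)
- have negE : (match psi with Atom _ _ | RAtom _ _ | Eq _ _ => False | _ => True end) ->
      has_value (Neg psi) /\ monotone_value (Neg psi).
    move=> nlit.
    have [|val mono] := IH (nnf [::] false psi).
      apply: leq_ltn_trans (weight_nnf _ _ _) _.
      by move: wt; rewrite ltnS; apply: leq_trans; case: psi nlit {IH}.
    split=> [rho /evaluable_nnf/val[k ek]|rho rho' k k' ev ev' le ek ek'].
      by exists k; apply: eval_neg.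
    apply: (mono rho rho'); [exact: evaluable_nnf|exact: evaluable_nnf| | |].
    - by rewrite free_relvars_nnf.
    - by move/eval_inv: ek; case: psi nlit {wt val mono ev ev' le ek'}.
    - by move/eval_inv: ek'; case: psi nlit {wt val mono ev ev' le ek}.
  case: psi wt negE => [R ts|X ts|t u|psi|p q|p q|x p|x p|mu X xs p ts] wt negE;
    try exact: negE.
  + split=> [rho [_ /closed_terms[a ->] _]|]; first by eexists; apply: eval_neg_atom.
    move=> rho rho' k k' _ _ _ /eval_inv[a -> ->] /eval_inv[b /elts_inj -> ->].
    exact: nle_refl.
  (* A negated relation variable occurs negatively, so it is not evaluable; no rule gives it a value
     either. *)
  + split=> [rho [_ _ pos]|rho rho' k k' _ _ _ /eval_inv //].
    by have [] := pos X (mem_head _ _); rewrite /occurs_positively /= eqxx.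
  + split=> [rho [_ /= fv _]|].
      case: t u fv {wt negE} => [x|a] [y|b] //= _; by eexists; apply: eval_neq.
    move=> rho rho' k k' _ _ _ /eval_inv[a [b [-> ->] ->]] /eval_inv[c [d [[->] [->]] ->]].
    exact: nle_refl.
- have [valp monop] : has_value p /\ monotone_value p.
    by apply: IH; move: wt; rewrite ltnS; apply: leq_ltn_trans; rewrite leq_addr.
  have [valq monoq] : has_value q /\ monotone_value q.
    by apply: IH; move: wt; rewrite ltnS; apply: leq_ltn_trans; rewrite leq_addl.
  split=> [rho [/= lf fv pos]|rho rho' k k' [/= lf fv pos] [_ _ pos'] le].
    have [/valp[k ek] /valq[l el]] := evaluable_cat lf fv pos.
    by exists (k + l); apply: eval_or.
  move=> /eval_inv[k1 [k2 [e1 e2] ->]] /eval_inv[k1' [k2' [e1' e2'] ->]].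
  have [evp evq] := evaluable_cat lf fv pos.
  have [evp' evq'] := evaluable_cat lf fv pos'.
  apply: nle_add; [apply: monop e1 e1'|apply: monoq e2 e2'] => //;
    by apply: env_le_sub le => X; rewrite mem_cat => ->; rewrite ?orbT.
- have [valp monop] : has_value p /\ monotone_value p.
    by apply: IH; move: wt; rewrite ltnS; apply: leq_ltn_trans; rewrite leq_addr.
  have [valq monoq] : has_value q /\ monotone_value q.
    by apply: IH; move: wt; rewrite ltnS; apply: leq_ltn_trans; rewrite leq_addl.
  split=> [rho [/= lf fv pos]|rho rho' k k' [/= lf fv pos] [_ _ pos'] le].
    have [/valp[k ek] /valq[l el]] := evaluable_cat lf fv pos.
    by exists (k * l); apply: eval_and.
  move=> /eval_inv[k1 [k2 [e1 e2] ->]] /eval_inv[k1' [k2' [e1' e2'] ->]].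
  have [evp evq] := evaluable_cat lf fv pos.
  have [evp' evq'] := evaluable_cat lf fv pos'.
  apply: nle_mul; [apply: monop e1 e1'|apply: monoq e2 e2'] => //;
    by apply: env_le_sub le => X; rewrite mem_cat => ->; rewrite ?orbT.
- have IHp a : has_value (inst [:: x] [:: a] p) /\ monotone_value (inst [:: x] [:: a] p).
    by apply: IH; rewrite weight_subst.
  split=> [rho [/= lf fv pos]|rho rho' k k' [/= lf fv pos] [_ _ pos'] le].
    have [f ef] := choice (fun a => (IHp a).1 rho (evaluable_quant a lf fv pos)).
    by eexists; apply: eval_ex ef.
  move=> /eval_inv[f ef ->] /eval_inv[f' ef' ->].
  (* The order relates the neutral element to itself and is compatible with the operation, so it
     passes from the terms to the finite sum. *)
  apply: (big_ind2 (@nle K)) => [|? ? ? ?|a _]; first exact: nle_refl.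
    exact: nle_add.
  apply: (IHp a).2 (ef a) (ef' a); do ?exact: evaluable_quant.
  by rewrite /inst free_relvars_subst.
- have IHp a : has_value (inst [:: x] [:: a] p) /\ monotone_value (inst [:: x] [:: a] p).
    by apply: IH; rewrite weight_subst.
  split=> [rho [/= lf fv pos]|rho rho' k k' [/= lf fv pos] [_ _ pos'] le].
    have [f ef] := choice (fun a => (IHp a).1 rho (evaluable_quant a lf fv pos)).
    by eexists; apply: eval_all ef.
  move=> /eval_inv[f ef ->] /eval_inv[f' ef' ->].
  apply: (big_ind2 (@nle K)) => [|? ? ? ?|a _]; first exact: nle_refl.
    exact: nle_mul.
  apply: (IHp a).2 (ef a) (ef' a); do ?exact: evaluable_quant.
  by rewrite /inst free_relvars_subst.
- have IHp (c : (rarity X).-tuple A) : has_value (inst xs c p) /\ monotone_value (inst xs c p).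
    by apply: IH; rewrite weight_subst.
  split; first by apply: has_value_fix => c; have [] := IHp c.
  by apply: monotone_value_fix => c; have [] := IHp c.
Qed.

End WellDefined.
End Semantics.

Theorem theorem7 (K : comNzSemiRingType)
    (hord : naturally_ordered K) (hK : fully_chain_complete K)
    (tau : vocabulary) (A : finType)
    (pi : literal tau A -> K) (hpi : is_interpretation pi) :
  (forall (rho : rel_env K A) (mu : fix_kind) (X : relvar)
     (xs : (rarity X).-tuple nat) (phi : formula tau A)
     (ts : (rarity X).-tuple (term A)),
     evaluable rho (Fix mu X xs phi ts) ->
     exists F, is_update_operator pi rho xs phi F /\
       exists h, is_fixed_point mu F h)
  /\
  (forall psi : formula tau A, lfp_sentence psi ->
     exists! k : K, eval pi (@empty_env K A) psi k).
Proof.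
have total phi := eval_total_monotone pi hord hK phi.
split=> [rho mu X xs phi ts ev|psi /and3P[lf /nilP fr /nilP fv]].
  by apply: update_operator_exists ev => // c; have [] := total (inst xs c phi).
(* A sentence has no free relation variables, so the empty environment suffices. *)
have ev : evaluable (@empty_env K A) psi by split=> // X; rewrite fr.
have [val mono] := total psi; have [k ek] := val _ ev.
exists k; split=> // l el.
by apply: (nle_anti hord); [apply: mono ek el|apply: mono el ek] => //; apply: env_le_refl.
Qed.
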